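(* For every stream $s$: if $\mu\mathcal{W}\,s$, then the set $\mathcal{R}_s$ of red positions of $s$ is streamless.
   Context: The statement is to be proved constructively (intuitionistic type theory with inductive and coinductive definitions; no excluded middle, no Markov's principle). A color is one of $R$ (red), $B$ (blue). A stream is an element of the coinductive type whose only constructor forms $c\,s$ from a color $c$ and a stream $s$; streams are considered up to bisimilarity (equivalently, functions $\mathbb{N}\to\{R,B\}$ up to pointwise equality). $s@n$ denotes the color of $s$ at position $n$ (positions start at $0$). For a stream predicate $X$, the weak until predicate $\mathcal{W}_X$ is defined coinductively by the rules: $\mathcal{W}_X\,s$ implies $\mathcal{W}_X\,(B\,s)$; $X\,s$ implies $\mathcal{W}_X\,(R\,s)$. The operator $X\mapsto\mathcal{W}_X$ is monotone, and $\mu\mathcal{W}$ (''almost always blue'') is its least fixed point, i.e. the predicate defined inductively by the rule: $\mathcal{W}_{\mu\mathcal{W}}\,s$ implies $\mu\mathcal{W}\,s$ (equivalently, Mendler-style: if $X$ is a stream predicate with $\forall s'.\,X\,s'\Rightarrow\mu\mathcal{W}\,s'$ and $\mathcal{W}_X\,s$, then $\mu\mathcal{W}\,s$). $\mathcal{R}_s=\{n\in\mathbb{N}\mid s@n=R\}$. For a set $A$, the duplicate-free colists $\mathit{colist}\,A$ over $A$ are defined coinductively: $\langle\rangle:\mathit{colist}\,A$; and if $x\in A$ and $\ell:\mathit{colist}\,(A\setminus\{x\})$ then $x\,\ell:\mathit{colist}\,A$. Finiteness $\ell\downarrow$ of a colist is defined inductively: $\langle\rangle\downarrow$; and $\ell\downarrow$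 implies $(x\,\ell)\downarrow$. $A$ is streamless if $\ell\downarrow$ for every $\ell:\mathit{colist}\,A$. *)

(* Defs.v *)
From Stdlib Require Import Streams Ensembles.

Set Implicit Arguments.

Inductive color : Set := R | B.

Definition stream : Type := Stream color.

CoInductive weak_until (X : stream -> Prop) : stream -> Prop :=
| weak_until_B s : weak_until X s -> weak_until X (Cons B s)
| weak_until_R s : X s -> weak_until X (Cons R s).

(** Almost always blue: the least fixed point of [weak_until].  The Mendler-style
    rule is used because Rocq derives no usable induction principle from
    [weak_until mu_weak_until s -> mu_weak_until s], whose recursive occurrence is
    nested under a coinductive predicate; that direct rule is the instance
    [X := mu_weak_until]. *)
Inductive mu_weak_until : stream -> Prop :=
| mu_weak_until_intro (X : stream -> Prop) s :
    (forall s', X s' -> mu_weak_until s') -> weak_until X s -> mu_weak_until s.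

Definition red_positions (s : stream) : Ensemble nat :=
  fun n => Str_nth n s = R.

(** Duplicate-free colists: [Subtract T A x] is the set [A] without [x]. *)
CoInductive colist (T : Type) (A : Ensemble T) : Type :=
| conil : colist A
| cocons (x : T) : In T A x -> colist (Subtract T A x) -> colist A.

Arguments conil {T A}.
Arguments cocons {T A} x _ _.

Inductive colist_finite (T : Type) (A : Ensemble T) : colist A -> Prop :=
| conil_finite : colist_finite conil
| cocons_finite (x : T) (Ax : In T A x) (l : colist (Subtract T A x)) :
    colist_finite l -> colist_finite (cocons x Ax l).

Definition streamless (T : Type) (A : Ensemble T) : Prop :=
  forall l : colist A, colist_finite l.

(* Main.v *)
(** By induction on [mu_weak_until s].  A nonempty colist over [red_positions s]
    exhibits a red position of [s], and unrolling [weak_until X s] up to that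
    position reaches the first red of [s], whose tail satisfies [X] and so has
    streamless red positions.  Prepending a color preserves this: the positions
    other than [0] are shifted by one, and a duplicate-free colist meets [0] at
    most once, so [0] can be dropped from it productively. *)

From Stdlib Require Import Streams Ensembles PeanoNat.
Require Import Defs.

Set Implicit Arguments.
#[local] Arguments In {U} A x.
#[local] Arguments Subtract {U} B x.

Definition maps_to (T U : Type) (f : T -> U) (A : Ensemble T) (C : Ensemble U) : Prop :=
  forall x, In A x -> In C (f x).

Definition injective_on (T U : Type) (f : T -> U) (A : Ensemble T) : Prop :=
  forall x y, In A x -> In A y -> f x = f y -> x = y.

Lemma in_Subtract {T : Type} {A : Ensemble T} {x y : T} :
  In A y -> y <> x -> In (Subtract A x) y.
Proof.
  intros Ay neq; split; [exact Ay|].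
  intros xy; apply neq.
  now destruct xy.
Qed.

Lemma Subtract_neq {T : Type} {A : Ensemble T} {x y : T} :
  In (Subtract A x) y -> y <> x.
Proof. intros [_ ny] ->; apply ny; constructor. Qed.

Lemma injective_on_Subtract (T U : Type) (f : T -> U) (A : Ensemble T) (x : T) :
  injective_on f A -> injective_on f (Subtract A x).
Proof. intros inj y z [Ay _] [Az _]; now apply inj. Qed.

(** Injectivity keeps images duplicate-free: no other element of [A] can land on [f x]. *)
Lemma maps_to_Subtract (T U : Type) (f : T -> U) (A : Ensemble T) (C : Ensemble U) (x : T) :
  maps_to f A C -> injective_on f A -> In A x ->
  maps_to f (Subtract A x) (Subtract C (f x)).
Proof.
  intros fAC inj Ax y Sy.
  pose proof Sy as [Ay _].
  apply in_Subtract; [now apply fAC|].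
  intros eq; apply (Subtract_neq Sy).
  now apply inj.
Qed.

Lemma Subtract_comm {T : Type} {A : Ensemble T} {x y z : T} :
  In (Subtract (Subtract A x) y) z -> In (Subtract (Subtract A y) x) z.
Proof. intros [[Az nx] ny]; repeat split; assumption. Qed.

CoFixpoint colist_map (T U : Type) (f : T -> U) (A : Ensemble T) (C : Ensemble U)
    (fAC : maps_to f A C) (inj : injective_on f A) (l : colist A) : colist C :=
  match l with
  | conil => conil
  | cocons x Ax l' =>
      cocons (f x) (fAC x Ax)
        (colist_map (maps_to_Subtract fAC inj Ax) (injective_on_Subtract inj) l')
  end.

(* Finiteness is measured by a natural number because inverting [colist_finite]
   on a computed colist needs equations between dependent pairs. *)
Fixpoint colist_length_le (T : Type) (n : nat) (A : Ensemble T) (l : colist A) : Prop :=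
  match l, n with
  | conil, _ => True
  | cocons _ _ _, O => False
  | cocons _ _ l', S n' => colist_length_le n' l'
  end.

Lemma colist_finite_length (T : Type) (A : Ensemble T) (l : colist A) :
  colist_finite l <-> exists n, colist_length_le n l.
Proof.
  split.
  - induction 1 as [A|A x Ax l _ [n len]]; [now exists 0|now exists (S n)].
  - intros [n len]; revert A l len.
    induction n as [|n IH]; intros A [|x Ax l] len;
      [constructor|destruct len|constructor|constructor; now apply IH].
Qed.

Lemma colist_map_length (T U : Type) (f : T -> U) (n : nat) (A : Ensemble T)
    (C : Ensemble U) (fAC : maps_to f A C) (inj : injective_on f A) (l : colist A) :
  colist_length_le n (colist_map fAC inj l) -> colist_length_le n l.
Proof.
  revert A C fAC inj l.
  induction n as [|n IH]; intros A C fAC inj [|x Ax l] len; try exact len.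
  exact (IH _ _ _ _ _ len).
Qed.

(** Mapping preserves length, so a bound for the image colist over [C] bounds the original. *)
Lemma streamless_injective (T U : Type) (f : T -> U) (A : Ensemble T) (C : Ensemble U) :
  maps_to f A C -> injective_on f A -> streamless C -> streamless A.
Proof.
  intros fAC inj sC l.
  destruct (proj1 (colist_finite_length _) (sC (colist_map fAC inj l))) as [n len].
  apply colist_finite_length; exists n.
  exact (colist_map_length n _ _ l len).
Qed.

Section Remove.

Variables (T : Type) (eq_dec : forall x y : T, {x = y} + {x <> y}) (a : T).

(** Once [a] is met, the tail cannot contain it again, so mapping by the identity merely retypes the
    tail. *)
Lemma maps_to_Subtract_eq (A C : Ensemble T) (x : T) :
  maps_to (fun y => y) (Subtract A a) C -> x = a ->
  maps_to (fun y => y) (Subtract A x) C.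
Proof. now intros AC ->. Qed.

Lemma maps_to_Subtract_neq (A C : Ensemble T) (x : T) :
  maps_to (fun y => y) (Subtract A a) C ->
  maps_to (fun y => y) (Subtract (Subtract A x) a) (Subtract C x).
Proof.
  intros AC y Sy.
  pose proof (Subtract_comm Sy) as Sy'.
  apply in_Subtract; [|exact (Subtract_neq Sy')].
  now apply AC; destruct Sy'.
Qed.

(* The target is any [C] containing [Subtract A a], because iterated [Subtract]s
   commute only extensionally. *)
CoFixpoint colist_remove (A C : Ensemble T)
    (AC : maps_to (fun y => y) (Subtract A a) C) (l : colist A) : colist C :=
  match l with
  | conil => conil
  | cocons x Ax l' =>
      match eq_dec x a with
      | left eq =>
          colist_map (maps_to_Subtract_eq AC eq) (fun y z _ _ yz => yz) l'
      | right neq =>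
          cocons x (AC x (in_Subtract Ax neq))
            (colist_remove (maps_to_Subtract_neq AC) l')
      end
  end.

(** The extra unit pays for the single possible occurrence of [a]. *)
Lemma colist_remove_length (n : nat) (A C : Ensemble T)
    (AC : maps_to (fun y => y) (Subtract A a) C) (l : colist A) :
  colist_length_le n (colist_remove AC l) -> colist_length_le (S n) l.
Proof.
  revert A C AC l.
  induction n as [|n IH]; intros A C AC [|x Ax l]; [easy| |easy|]; cbn;
    destruct (eq_dec x a) as [eq|neq].
  (* The head is [a] and nothing may remain after its removal, so the tail is empty. *)
  - destruct l; [easy|intros []].
  - intros [].
  - destruct l as [|y Sy l]; [easy|].
    exact (colist_map_length n _ _ l).
  - exact (IH _ _ _ l).
Qed.

(** Whether [a] occurs in [l] is never decided; each entry is only compared with [a] when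
    reached. *)
Lemma streamless_Subtract (A : Ensemble T) :
  streamless (Subtract A a) -> streamless A.
Proof.
  intros sA l.
  set (AA := (fun y Sy => Sy) : maps_to (fun y => y) (Subtract A a) (Subtract A a)).
  destruct (proj1 (colist_finite_length _) (sA (colist_remove AA l))) as [n len].
  apply colist_finite_length; exists (S n).
  exact (colist_remove_length n AA l len).
Qed.

End Remove.

Lemma streamless_red_positions_Cons (c : color) (s : stream) :
  streamless (red_positions s) -> streamless (red_positions (Cons c s)).
Proof.
  intros ss.
  apply (streamless_Subtract Nat.eq_dec (a := 0)).
  (* [pred] sends both [0] and [1] to [0], so it is injective only after [0] is removed. *)
  apply (streamless_injective (f := pred) (C := red_positions s)); [| |exact ss].
  - intros [|n] Sn; [now destruct (Subtract_neq Sn)|].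
    now destruct Sn as [Rn _].
  - intros [|m] [|n] Sm Sn eq; cbn in eq;
      [now destruct (Subtract_neq Sm)..| now destruct (Subtract_neq Sn) |].
    now rewrite eq.
Qed.

(** The position [n] only bounds the unrolling: a blue head lowers it by one, and a red head ends
    the search, possibly before [n] is reached. *)
Lemma weak_until_streamless (X : stream -> Prop) (s : stream) (n : nat) :
  (forall s', X s' -> streamless (red_positions s')) ->
  weak_until X s -> red_positions s n -> streamless (red_positions s).
Proof.
  intros sX; revert s.
  induction n as [|n IH]; intros s [s' Ws'|s' Xs'] Rn;
    apply streamless_red_positions_Cons.
  - discriminate Rn.
  - now apply sX.
  - now apply IH.
  - now apply sX.
Qed.

Theorem lemma4p3 (s : stream) :
  mu_weak_until s -> streamless (red_positions s).
Proof.
  induction 1 as [X s _ IH Ws].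
  (* Whether [s] has a red position is undecidable in general; the colist itself settles the case,
     being empty or supplying [n]. *)
  intros [|n Rn l]; [constructor|].
  now apply (weak_until_streamless IH Ws Rn).
Qed.
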